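(* Let $\mathcal{H}$ be a real Hilbert space, let $A_1, A_2:\mathcal{H}\to 2^{\mathcal{H}}$ be maximally monotone, let $B:\mathcal{H}\to\mathcal{H}$ be monotone and $L$-Lipschitz continuous ($L>0$), let $C:\mathcal{H}\to\mathcal{H}$ be $\beta$-cocoercive ($\beta>0$), and assume that $\mathrm{zer}(A_1+A_2+B+C)\neq\emptyset$. Let $\gamma\in\left(0,\frac{\beta}{2(1+4\beta L)}\right)$. Let $z_0,y_0,y_{-1}\in\mathcal{H}$ and define for $n\ge0$ $$x_{n+1}=J_{\gamma A_1}z_n,\qquad y_{n+1}=J_{\gamma A_2}\big(2x_{n+1}-z_n-2\gamma By_n+\gamma By_{n-1}-\gamma Cy_n\big),\qquad z_{n+1}=z_n+y_{n+1}-x_{n+1}.$$ Then: (i) $\{z_n\}$ converges weakly to a point $\bar z\in\mathcal{H}$; (ii) $\{x_n\}$ and $\{y_n\}$ converge weakly to a point $\bar x\in\mathcal{H}$; (iii) $\bar x=J_{\gamma A_1}(\bar z)\in\mathrm{zer}(A_1+A_2+B+C)$.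
   Context: $J_{\gamma A}=(\mathrm{Id}+\gamma A)^{-1}$ denotes the resolvent of a maximally monotone operator $A$. $\mathrm{zer}(T)=\{x: 0\in Tx\}$. $C$ is $\beta$-cocoercive if $\langle x-y,Cx-Cy\rangle\ge\beta\|Cx-Cy\|^2$ for all $x,y\in\mathcal{H}$. *)

(* Defs.v *)
From HB Require Import structures.
From mathcomp Require Import all_boot all_order all_algebra.
From mathcomp Require Import all_classical all_reals all_analysis.
Set Implicit Arguments. Unset Strict Implicit. Unset Printing Implicit Defensive.
Import Order.TTheory GRing.Theory Num.Theory.
Import numFieldNormedType.Exports.
Local Open Scope classical_set_scope.
Local Open Scope ring_scope.

Definition is_inner_product (R : realType) (V : lmodType R) (ip : V -> V -> R) : Prop :=
  (forall x y, ip x y = ip y x) /\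
  (forall (a : R) x y z, ip (a *: x + y) z = a * ip x z + ip y z) /\
  (forall x, 0 <= ip x x) /\
  (forall x, ip x x = 0 -> x = 0).

Definition hnorm (R : realType) (V : lmodType R) (ip : V -> V -> R) (x : V) : R :=
  Num.sqrt (ip x x).

Definition ip_complete (R : realType) (V : lmodType R) (ip : V -> V -> R) : Prop :=
  forall u : nat -> V,
    (forall e : R, 0 < e -> exists N : nat, forall m n : nat,
        (N <= m)%N -> (N <= n)%N -> hnorm ip (u m - u n) < e) ->
    exists l : V, (fun n => hnorm ip (u n - l)) @ \oo --> (0 : R).

Definition is_hilbert (R : realType) (V : lmodType R) (ip : V -> V -> R) : Prop :=
  is_inner_product ip /\ ip_complete ip.

(* Set-valued operators V -> 2^V are relations: A x u  means  u \in A x. *)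
Definition monotone_op (R : realType) (V : lmodType R) (ip : V -> V -> R)
  (A : V -> V -> Prop) : Prop :=
  forall x y u v, A x u -> A y v -> 0 <= ip (x - y) (u - v).

Definition maximally_monotone (R : realType) (V : lmodType R) (ip : V -> V -> R)
  (A : V -> V -> Prop) : Prop :=
  monotone_op ip A /\
  (forall x u, (forall y v, A y v -> 0 <= ip (x - y) (u - v)) -> A x u).

Definition monotone_fun (R : realType) (V : lmodType R) (ip : V -> V -> R)
  (B : V -> V) : Prop :=
  forall x y, 0 <= ip (x - y) (B x - B y).

Definition lipschitz_fun (R : realType) (V : lmodType R) (ip : V -> V -> R)
  (L : R) (B : V -> V) : Prop :=
  forall x y, hnorm ip (B x - B y) <= L * hnorm ip (x - y).

Definition cocoercive (R : realType) (V : lmodType R) (ip : V -> V -> R)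
  (beta : R) (C : V -> V) : Prop :=
  forall x y, beta * ip (C x - C y) (C x - C y) <= ip (x - y) (C x - C y).

(* x = J_{g A} z, i.e. x \in (Id + g A)^{-1} z, i.e. z \in x + g A x.
   (Single-valued and everywhere defined when A is maximally monotone, g > 0.) *)
Definition is_resolvent (R : realType) (V : lmodType R)
  (A : V -> V -> Prop) (g : R) (z x : V) : Prop :=
  exists u, A x u /\ z = x + g *: u.

Definition in_zer4 (R : realType) (V : lmodType R)
  (A1 A2 : V -> V -> Prop) (B C : V -> V) (x : V) : Prop :=
  exists a1 a2, A1 x a1 /\ A2 x a2 /\ a1 + a2 + B x + C x = 0.

Definition weak_cvg (R : realType) (V : lmodType R) (ip : V -> V -> R)
  (u : nat -> V) (l : V) : Prop :=
  forall w : V, (fun n => ip (u n) w) @ \oo --> ip l w.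

(* Main.v *)
Require Import Defs.
From HB Require Import structures.
From mathcomp Require Import all_boot all_order all_algebra.
From mathcomp Require Import all_classical all_reals all_analysis.
From mathcomp Require Import ring lra.
Import Order.TTheory GRing.Theory Num.Theory.
Import numFieldNormedType.Exports.
Local Open Scope classical_set_scope.
Local Open Scope ring_scope.

Set Implicit Arguments.
Unset Strict Implicit.
Unset Printing Implicit Defensive.

(* Write [x*] for a zero of [A1 + A2 + B + C] with [a1] in [A1 x*] the chosen
   summand, and [z* = x* + gamma a1].  Monotonicity of the four operators shows that

     |z_n - z*|^2 - 2 gamma <y_n - x*, B y_n - B y_{n-1}>
       + gamma L |y_n - y_{n-1}|^2 + (gamma / beta + 4 gamma L) |z_n - z_{n-1}|^2

   decreases by at least a fixed multiple of |z_{n+1} - z_n|^2; the bound on the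
   differences of the y_n comes from the firm nonexpansiveness of the resolvent of
   A1, which gives |y_{n+1} - y_n|^2 <= 2 (|z_{n+1} - z_n|^2 + |z_n - z_{n-1}|^2).
   This quantity also dominates (1 - 8 gamma L) |z_n - z*|^2.  Hence (z_n) is
   bounded, successive differences tend to 0, and |z_n - z*| converges for each z*.

   Weak cluster points are taken along ultrafilters on nat, where bounded sequences
   have weak limits by Riesz representation.  Passing to the limit in the sum of the
   monotonicity inequalities of A1, A2 and B + C, in which the quadratic terms cancel
   up to strongly vanishing ones, and using the maximality of each operator, every
   cluster point of (z_n) is some z*.  Opial's argument gives uniqueness. *)

(** * Limits along ultrafilters *)

(** Otherwise [f] is at distance at least [e] from [l] on a set meeting every element of [F].
    Restricting [F] to that set gives a proper filter, and an ultrafilter refining it contradicts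
    the hypothesis. *)
Lemma cvg_ultra (R : realType) (T : Type) (F : set_system T) (f : T -> R)
    (l : R) : Filter F ->
  (forall U, UltraFilter U -> F `<=` U -> f @ U --> l) -> f @ F --> l.
Proof.
move=> FF fU; apply: contrapT => /cvgrPdist_lt nfl.
have {nfl}[e e0 nFe] : exists2 e, 0 < e & ~ F [set t | `|l - f t| < e].
  apply: contrapT => ne; apply: nfl => e e0; apply: contrapT => nFe.
  by apply: ne; exists e.
set A := ~` [set t | `|l - f t| < e].
have WF : ProperFilter (within A F).
  apply: Build_ProperFilter_ex => B WB; apply: contrapT => B0.
  apply: nFe; apply: (filterS _ (WB : F _)) => t AB; apply: contrapT => At.
  by apply: B0; exists t; exact: AB.
have [U [UU WU]] := ultraFilterLemma WF.
have FU : F `<=` U by move=> B FB; apply: WU; apply: filterS FB => t Bt _.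
have /cvgrPdist_lt/(_ e e0) Ue := fU U UU FU.
have UA : U A by apply: WU; exact: (@nearW _ F).
have : U set0 by apply: filterS2 Ue UA => t te; apply.
exact: filter_not_empty.
Qed.

(** The image of an ultrafilter is an ultrafilter, here one containing the compact segment from
    [- M] to [M]. *)
Lemma ultra_bounded_cvg (R : realType) (T : Type) (U : set_system T)
    (f : T -> R) (M : R) : UltraFilter U ->
  (\forall t \near U, `|f t| <= M) -> exists l : R, f @ U --> l.
Proof.
move=> UU fM.
have fUU : UltraFilter (f @ U).
  constructor; first exact: fmap_proper_filter.
  move=> G GF sub; apply/seteqP; split => // B GB.
  have [//|UnB] := in_ultra_setVsetC (f @^-1` B) UU.
  have /sub GnB : (f @ U) (~` B) by [].
  exfalso; apply: (@filter_not_empty _ G).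
  by apply: filterS2 GB GnB => t Bt; apply.
have := @segment_compact R (- M) M; rewrite compact_ultra => /(_ _ fUU).
case=> [|l [_ lU]]; last by exists l.
by apply: filterS fM => t; rewrite /= in_itv /= ler_norml.
Qed.

(** * Inner product identities and inequalities *)

Section InnerProduct.
Variables (R : realType) (V : lmodType R) (ip : V -> V -> R).
Hypothesis ipP : is_inner_product ip.
Implicit Types (u v w x y : V).

Lemma ipC u v : ip u v = ip v u.
Proof. by case: ipP. Qed.

Lemma ip0l u : ip 0 u = 0.
Proof.
case: ipP => _ [lin _]; have := lin 1 0 0 u.
by rewrite scale1r addr0 mul1r; lra.
Qed.

Lemma ipDl u v w : ip (u + v) w = ip u w + ip v w.
Proof. by case: ipP => _ [lin _]; rewrite -[u]scale1r lin scale1r mul1r. Qed.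

Lemma ipZl (a : R) u w : ip (a *: u) w = a * ip u w.
Proof. by case: ipP => _ [lin _]; rewrite -[_ *: u]addr0 lin ip0l addr0. Qed.

Lemma ipNl u w : ip (- u) w = - ip u w.
Proof. by rewrite -scaleN1r ipZl mulN1r. Qed.

Lemma ipDr u v w : ip w (u + v) = ip w u + ip w v.
Proof. by rewrite ipC ipDl !(ipC w). Qed.

Lemma ipZr (a : R) u w : ip w (a *: u) = a * ip w u.
Proof. by rewrite ipC ipZl ipC. Qed.

Lemma ipNr u w : ip w (- u) = - ip w u.
Proof. by rewrite ipC ipNl ipC. Qed.

Definition ipE := (ipDl, ipDr, ipNl, ipNr, ipZl, ipZr).

Lemma ip_ge0 u : 0 <= ip u u.
Proof. by case: ipP => _ [_ []]. Qed.

Lemma ip_eq0 u : ip u u = 0 -> u = 0.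
Proof. by case: ipP => _ [_ [_]]; apply. Qed.

(** Reduces vector identities to scalar ones, which [ring] or [field] closes after expansion by
    [ipE]. *)
Lemma ip_inj u v : (forall w, ip u w = ip v w) -> u = v.
Proof.
by move=> uv; apply/eqP; rewrite -subr_eq0; apply/eqP/ip_eq0; rewrite ipDl ipNl uv subrr.
Qed.

Lemma ip_young (t : R) u v : 0 < t -> 2 * ip u v <= t * ip u u + t^-1 * ip v v.
Proof.
move=> t0; rewrite -(ler_pM2l t0) [leRHS]mulrDr [t * (t^-1 * _)]mulrA.
rewrite mulfV ?gt_eqF//; have := ip_ge0 (t *: u - v).
by rewrite !ipE (ipC v u); lra.
Qed.

Lemma ip_young_norm (t : R) u v :
  0 < t -> `|2 * ip u v| <= t * ip u u + t^-1 * ip v v.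
Proof.
move=> t0; rewrite ler_norml ip_young// andbT lerNl.
by have := ip_young (- u) v t0; rewrite !ipE !mulrN opprK.
Qed.

Lemma ip_sqrD u v : ip (u + v) (u + v) <= 2 * (ip u u + ip v v).
Proof. by have := ip_ge0 (u - v); rewrite !ipE (ipC v u); lra. Qed.

Lemma ip_sqrB u v : ip (u - v) (u - v) <= 2 * (ip u u + ip v v).
Proof. by have := ip_sqrD u (- v); rewrite !ipE; lra. Qed.

Lemma ip_CS u v : ip u v ^+ 2 <= ip u u * ip v v.
Proof.
have [v0|v0] := eqVneq (ip v v) 0.
  by rewrite v0 (ip_eq0 v0) ipC ip0l mulr0 expr0n.
have vp : 0 < ip v v by rewrite lt_def v0 ip_ge0.
have := ip_ge0 (ip v v *: u - ip u v *: v).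
by rewrite !ipE (ipC v u) => h; rewrite -(ler_pM2l vp); lra.
Qed.

(** * Strong and weak limits along a filter *)

(** Squared norms avoid square roots; a general [F] covers both [\oo] and the ultrafilters refining
    it. *)
Definition strong0 (T : Type) (F : set_system T) (s : T -> V) : Prop :=
  (fun n => ip (s n) (s n)) @ F --> (0 : R).

Definition norm_bounded (T : Type) (F : set_system T) (s : T -> V) : Prop :=
  exists M : R, \forall n \near F, ip (s n) (s n) <= M.

Definition weak_lim (T : Type) (F : set_system T) (s : T -> V) (l : V) : Prop :=
  forall w : V, (fun n => ip (s n) w) @ F --> ip l w.

Section Limits.
Variables (T : Type) (F : set_system T).
Context {FF : Filter F}.
Implicit Types (s t : T -> V).

Lemma strong0_dom (K : R) (f : T -> R) s : f @ F --> (0 : R) ->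
  (\forall n \near F, ip (s n) (s n) <= K * f n) -> strong0 F s.
Proof.
move=> f0 sf; apply: (@squeeze_cvgr _ F _ R (fun=> 0) (fun n => K * f n)).
- by apply: filterS sf => n ->; rewrite ip_ge0.
- exact: cvg_cst.
- by rewrite -[X in _ --> X](mulr0 K); apply: cvgM f0; exact: cvg_cst.
Qed.

Lemma strong0D s t : strong0 F s -> strong0 F t -> strong0 F (fun n => s n + t n).
Proof.
move=> s0 t0; apply: (@strong0_dom 2 (fun n => ip (s n) (s n) + ip (t n) (t n))).
  by rewrite -[X in _ --> X](addr0 0); exact: cvgD.
by apply: nearW => n; exact: ip_sqrD.
Qed.

Lemma strong0Z (a : R) s : strong0 F s -> strong0 F (fun n => a *: s n).
Proof.
move=> s0; apply: (@strong0_dom (a * a) (fun n => ip (s n) (s n))) => //.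
by apply: nearW => n; rewrite !ipE mulrA.
Qed.

Lemma strong0_lip (K : R) (B : V -> V) s t :
  (forall u v, ip (B u - B v) (B u - B v) <= K * ip (u - v) (u - v)) ->
  strong0 F (fun n => s n - t n) -> strong0 F (fun n => B (s n) - B (t n)).
Proof.
move=> BK st; apply: (@strong0_dom K (fun n => ip (s n - t n) (s n - t n))) => //.
by apply: nearW => n; exact: BK.
Qed.

Lemma strong0_bounded s : strong0 F s -> norm_bounded F s.
Proof.
move=> /cvgrPdist_lt/(_ 1 ltr01) s0; exists 1; apply: filterS s0 => n.
by rewrite sub0r normrN => /ltW; apply: le_trans; exact: ler_norm.
Qed.

Lemma norm_boundedD s t :
  norm_bounded F s -> norm_bounded F t -> norm_bounded F (fun n => s n + t n).
Proof.
move=> [M sM] [N tN]; exists (2 * (M + N)); apply: filterS2 sM tN => n sM tN.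
by apply: (le_trans (ip_sqrD _ _)); lra.
Qed.

Lemma norm_boundedZ (a : R) s :
  norm_bounded F s -> norm_bounded F (fun n => a *: s n).
Proof.
move=> [M sM]; exists (a * a * M); apply: filterS sM => n sM.
by rewrite !ipE mulrA ler_wpM2l// -expr2 sqr_ge0.
Qed.

Lemma norm_boundedB s t :
  norm_bounded F s -> norm_bounded F t -> norm_bounded F (fun n => s n - t n).
Proof.
move=> bs bt; under eq_fun do rewrite -scaleN1r.
by apply: norm_boundedD => //; exact: norm_boundedZ.
Qed.

Lemma norm_bounded_lip (K : R) (B : V -> V) s : 0 <= K ->
  (forall u v, ip (B u - B v) (B u - B v) <= K * ip (u - v) (u - v)) ->
  norm_bounded F s -> norm_bounded F (fun n => B (s n)).
Proof.
move=> K0 BK [M sM]; exists (2 * (K * M + ip (B 0) (B 0))).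
apply: filterS sM => n sM.
have := ip_sqrD (B (s n) - B 0) (B 0); rewrite subrK => /le_trans; apply.
rewrite ler_pM2l// lerD2r; apply: (le_trans (BK _ _)).
by rewrite subr0 ler_wpM2l.
Qed.

Lemma strong0_ip s t :
  strong0 F s -> norm_bounded F t -> (fun n => ip (s n) (t n)) @ F --> (0 : R).
Proof.
move=> s0 [M tM]; apply/cvgrPdist_lt => e e0.
have K0 : 0 < `|M| + 1 by rewrite ltr_wpDl.
have e2 : 0 < e ^+ 2 / (`|M| + 1) by rewrite divr_gt0// exprn_gt0.
move/cvgrPdist_lt/(_ _ e2): s0 => s0; apply: filterS2 s0 tM => n.
rewrite sub0r normrN ger0_norm ?ip_ge0// => sn tn.
rewrite sub0r normrN -(@ltr_pXn2r _ 2)//= ?nnegrE ?ltW//.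
rewrite real_normK ?num_real//; apply: (le_lt_trans (ip_CS _ _)).
apply: (@le_lt_trans _ _ (ip (s n) (s n) * (`|M| + 1))).
  rewrite ler_wpM2l ?ip_ge0//; apply: (le_trans tn).
  by apply: (le_trans (ler_norm M)); rewrite lerDl.
by rewrite -ltr_pdivlMr.
Qed.

Lemma weak_limD s t l m :
  weak_lim F s l -> weak_lim F t m -> weak_lim F (fun n => s n + t n) (l + m).
Proof.
move=> sl tm w; rewrite ipDl.
rewrite (_ : (fun n => ip _ _) = (fun n => ip (s n) w + ip (t n) w)).
  exact: cvgD.
by apply/funext => n; rewrite ipDl.
Qed.

Lemma weak_limZ (a : R) s l :
  weak_lim F s l -> weak_lim F (fun n => a *: s n) (a *: l).
Proof.
move=> sl w; rewrite ipZl.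
rewrite (_ : (fun n => ip _ _) = (fun n => a * ip (s n) w)).
  by apply: cvgM (sl w); exact: cvg_cst.
by apply/funext => n; rewrite ipZl.
Qed.

Lemma weak_limB s t l m :
  weak_lim F s l -> weak_lim F t m -> weak_lim F (fun n => s n - t n) (l - m).
Proof.
move=> sl tm; rewrite -scaleN1r; under eq_fun do rewrite -scaleN1r.
by apply: weak_limD => //; exact: weak_limZ.
Qed.

Lemma strong0_weak_lim s : strong0 F s -> weak_lim F s 0.
Proof.
move=> s0 w; rewrite ip0l; apply: (@strong0_ip s (fun=> w)) => //.
by exists (ip w w); apply: nearW.
Qed.

Lemma weak_lim_add_strong0 s t l :
  weak_lim F s l -> strong0 F (fun n => t n - s n) -> weak_lim F t l.
Proof.
move=> sl ts; have := weak_limD sl (strong0_weak_lim ts).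
by rewrite addr0 (_ : (fun n => _) = t)//; apply/funext => n; rewrite addrC subrK.
Qed.

End Limits.

Lemma strong0_sub (T : Type) (F G : set_system T) (s : T -> V) :
  F `<=` G -> strong0 F s -> strong0 G s.
Proof. by move=> FG; exact: cvg_trans (cvg_app _ FG). Qed.

Lemma norm_bounded_sub (T : Type) (F G : set_system T) (s : T -> V) :
  F `<=` G -> norm_bounded F s -> norm_bounded G s.
Proof. by move=> FG [M sM]; exists M; exact: FG. Qed.

Lemma strong0_shift (s : nat -> V) : strong0 \oo s -> strong0 \oo (fun n => s n.+1).
Proof. by rewrite /strong0 -cvg_shiftS. Qed.

Lemma norm_bounded_translate (s : nat -> V) p :
  norm_bounded \oo (fun n => s n - p) -> norm_bounded \oo s.
Proof.
move=> bs; have : norm_bounded \oo (fun n => s n - p + p).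
  by apply: norm_boundedD => //; exists (ip p p); exact: nearW.
by under eq_fun do rewrite subrK.
Qed.

(** * Riesz representation and weak compactness *)

(** For nonzero [a], the value r = -a / (|b| + 1) makes the expression negative. *)
Lemma affine_quad_eq0 (a b : R) : (forall r, 0 <= r * a + r ^+ 2 * b) -> a = 0.
Proof.
move=> h; apply/eqP/negPn/negP => a0.
have b1 : 0 < `|b| + 1 by rewrite ltr_wpDl.
have := h (- a / (`|b| + 1)); rewrite exprMn mulNr mulNr.
have -> : - (a / (`|b| + 1) * a) + (- a) ^+ 2 * (`|b| + 1)^-1 ^+ 2 * b =
          - (a ^+ 2 * (`|b| + 1)^-1 ^+ 2 * (`|b| + 1 - b)).
  by field; rewrite gt_eqF.
rewrite oppr_ge0 leNgt => /negP; apply.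
apply: mulr_gt0; last by have := ler_norm b; lra.
by apply: mulr_gt0; [rewrite exprn_even_gt0|rewrite exprn_gt0 ?invr_gt0].
Qed.

(* The representing vector is the minimiser of [|w|^2 - 2 phi w]. *)
Lemma riesz_representation (phi : V -> R) (M : R) : ip_complete ip ->
  (forall a u v, phi (a *: u + v) = a * phi u + phi v) ->
  (forall u, phi u ^+ 2 <= M * ip u u) ->
  exists l, forall u, phi u = ip l u.
Proof.
move=> cpl lin bnd; pose J w := ip w w - 2 * phi w.
have phi0 : phi 0 = 0.
  have := lin 1 0 0; rewrite scale1r addr0; lra.
have phiZ a u : phi (a *: u) = a * phi u by rewrite -[_ *: u]addr0 lin phi0 addr0.
have phiD u v : phi (u + v) = phi u + phi v by rewrite -[u]scale1r lin scale1r mul1r.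
(* By the arithmetic-geometric mean inequality, 2 phi w <= 2 sqrt(|M|) |w| <= |w|^2 + |M|. *)
have J_ge w : - `|M| <= J w.
  suff : 2 * phi w <= ip w w + `|M| by rewrite /J; lra.
  have [|p0] := ltP (phi w) 0; first by have := ip_ge0 w; have := normr_ge0 M; lra.
  rewrite -(@ler_pXn2r _ 2)//= ?nnegrE ?addr_ge0 ?ip_ge0 ?mulr_ge0//.
  have := bnd w; have : M * ip w w <= `|M| * ip w w.
    by rewrite ler_wpM2r ?ip_ge0// ler_norm.
  have := sqr_ge0 (ip w w - `|M|); lra.
pose E := range J.
have Einf : has_inf E.
  by split; [exists (J 0); exists 0|exists (- `|M|) => _ [w _ <-]].
pose j := inf E.
have Jj w : j <= J w by apply: ge_inf; [case: Einf|exists w].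
have /choice[s sJ] : forall n : nat, exists w, J w < j + n.+1%:R^-1.
  move=> n; have n0 : 0 < n.+1%:R^-1 :> R by rewrite invr_gt0.
  by have [_ [w _ <-] Jw] := inf_adherent n0 Einf; exists w.
(* Parallelogram law, with [J] bounded below by [j] at the midpoint; it makes the minimising
   sequence [s] Cauchy. *)
have par u v : ip (u - v) (u - v) <= 2 * (J u - j) + 2 * (J v - j).
  have := Jj (2^-1 *: (u + v)).
  by rewrite /J phiZ phiD !ipE (ipC v u); lra.
have invS (e : R) : 0 < e -> exists N : nat, forall n, (N <= n)%N -> n.+1%:R^-1 < e.
  move=> e0; have : (fun n => n.+1%:R^-1 : R) @ \oo --> (0 : R) by exact: cvg_harmonic.
  move=> /cvgrPdist_lt/(_ e e0)[N _ hN]; exists N => n Nn.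
  by have := hN n Nn; rewrite /= sub0r normrN ger0_norm// invr_ge0.
have [|l sl] := cpl s.
  move=> e e0; have e2 : 0 < e ^+ 2 / 4 by rewrite divr_gt0// exprn_gt0.
  have [N hN] := invS _ e2; exists N => m n Nm Nn.
  rewrite /hnorm -(@ltr_pXn2r _ 2)//= ?nnegrE ?sqrtr_ge0 ?ltW//.
  rewrite sqr_sqrtr ?ip_ge0//; apply: (le_lt_trans (par _ _)).
  move: (sJ m) (sJ n) (hN _ Nm) (hN _ Nn).
  by move: m.+1%:R^-1 n.+1%:R^-1 => em en; lra.
have s0 : strong0 \oo (fun n => s n - l).
  rewrite /strong0 -[X in _ --> X](mulr0 (0 : R)).
  rewrite (_ : (fun n => _) = (fun n => hnorm ip (s n - l) * hnorm ip (s n - l))).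
    exact: (cvgM sl sl).
  by apply/funext => n; rewrite /hnorm -expr2 sqr_sqrtr ?ip_ge0.
have wl : weak_lim \oo s l.
  apply: (@weak_lim_add_strong0 _ \oo _ (fun=> l)) => // w.
  exact: cvg_cst.
exists l => u; apply/esym/eqP; rewrite -subr_eq0; apply/eqP.
(* First-order condition at the minimum, obtained by letting n grow in j <= J (s n + r u), so that
   [J l] need not be evaluated. *)
suff h r : 0 <= r * (2 * (ip l u - phi u)) + r ^+ 2 * ip u u.
  by have /affine_quad_eq0 := h; lra.
have : (fun n : nat => r * (2 * (ip (s n) u - phi u)) + r ^+ 2 * ip u u + n.+1%:R^-1)
    @ \oo --> r * (2 * (ip l u - phi u)) + r ^+ 2 * ip u u + 0.
  apply: cvgD; last exact: cvg_harmonic.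
  apply: cvgD; last exact: cvg_cst.
  apply: cvgM; first exact: cvg_cst.
  apply: cvgM; first exact: cvg_cst.
  by apply: cvgB (wl u) _; exact: cvg_cst.
move=> /cvgr_to_ge; rewrite addr0; apply; apply: nearW => n.
have := Jj (s n + r *: u); have := sJ n.
by rewrite /J phiD phiZ !ipE (ipC u (s n)); move: n.+1%:R^-1 => en; lra.
Qed.

(** Each scalar sequence <s n, w> is bounded, hence converges along [U]; the limit is a bounded
    linear functional of [w], which Riesz represents. *)
Lemma ultra_weak_lim (T : Type) (U : set_system T) (s : T -> V) :
  ip_complete ip -> UltraFilter U -> norm_bounded U s -> exists l, weak_lim U s l.
Proof.
move=> cpl UU [M sM].
have bnd w : \forall n \near U, `|ip (s n) w| <= M + ip w w.
  apply: filterS sM => n sM; have := ip_young_norm (s n) w ltr01.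
  rewrite invr1 !mul1r normrM ger0_norm//.
  by have := ip_ge0 (s n); have := ip_ge0 w; lra.
have /choice[phi phiP] : forall w, exists a : R, (fun n => ip (s n) w) @ U --> a.
  by move=> w; exact: ultra_bounded_cvg (bnd w).
have [||l lP] := @riesz_representation phi M cpl.
- move=> a u v; apply: (cvg_unique _ (phiP _)) => //=.
  rewrite (_ : (fun n => _) = (fun n => a * ip (s n) u + ip (s n) v)); last first.
    by apply/funext => n; rewrite !ipE.
  by apply: cvgD (phiP v); apply: cvgM (phiP u); exact: cvg_cst.
- move=> u; rewrite -subr_ge0.
  have : (fun n => M * ip u u - ip (s n) u * ip (s n) u) @ U -->
      M * ip u u - phi u * phi u.
    by apply: cvgB; [exact: cvg_cst|exact: cvgM].
  move=> /cvgr_to_ge; apply; apply: filterS sM => n sM.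
  rewrite subr_ge0 -expr2; apply: (le_trans (ip_CS _ _)).
  by rewrite ler_wpM2r ?ip_ge0.
by exists l => w; rewrite -lP.
Qed.

(** * Maximally monotone operators *)

Definition maximal_op (A : V -> V -> Prop) : Prop :=
  forall x u, (forall y v, A y v -> 0 <= ip (x - y) (u - v)) -> A x u.

Lemma maximal_op_le0 A x u : maximal_op A ->
  exists y v, A y v /\ ip (x - y) (u - v) <= 0.
Proof.
move=> Amax; have [Axu|nA] := pselect (A x u).
  by exists x, u; split => //; rewrite subrr ip0l.
apply: contrapT => h; apply: nA; apply: Amax => y v Ayv.
by rewrite leNgt; apply/negP => /ltW ?; apply: h; exists y, v.
Qed.

(* Minty's trick, with the test point [x + r (u - F x)] for a small [r]. *)
Lemma lipschitz_maximal (K : R) (F : V -> V) : 0 <= K ->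
  (forall u v, ip (F u - F v) (F u - F v) <= K * ip (u - v) (u - v)) ->
  maximal_op (fun x u => u = F x).
Proof.
move=> K0 FK x u h; apply/eqP; rewrite -subr_eq0; apply/eqP/ip_eq0.
have [w wE] : exists w, w = u - F x by exists (u - F x).
(* This [r] gives K r^2 <= 1/4, so |d| <= |w| / 2 and <w, w - d> is positive unless [w] vanishes. *)
have [r rE] : exists r, r = (2 * (K + 1))^-1 by exists (2 * (K + 1))^-1.
have r0 : 0 < r by rewrite rE invr_gt0; lra.
have Kr : K * r ^+ 2 <= 4^-1.
  have K1 : 0 < 2 * (K + 1) by lra.
  rewrite rE exprVn ler_pdivrMr ?exprn_gt0//.
  by have := sqr_ge0 K; lra.
have [d dE] : exists d, d = F (x + r *: w) - F x by eexists.
have := h (x + r *: w) _ erefl; have := FK (x + r *: w) x.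
have -> : u - F (x + r *: w) = w - d.
  by rewrite dE wE opprB addrA subrK.
have h2 : 0 < 2^-1 :> R by rewrite invr_gt0.
rewrite -dE -wE => dK; have := ip_young w d h2; rewrite invrK.
move: dK; rewrite opprD addrA subrr sub0r [x + _]addrC addrK !ipE => dK yw wd.
have {wd} : 0 <= r * (ip w d - ip w w) by lra.
rewrite pmulr_rge0// => wd; have := ip_ge0 w.
have : K * (r * (r * ip w w)) <= 4^-1 * ip w w.
  by rewrite [r * _]mulrA [K * _]mulrA -expr2 ler_wpM2r ?ip_ge0.
lra.
Qed.

(* The infimum of [<x - y, u - v>] over the graph of a maximal operator is never
   positive, so if three of them have a nonnegative sum, all three vanish. *)
Lemma maximal_op_sum3 A1 A2 A3 x1 u1 x2 u2 x3 u3 :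
  maximal_op A1 -> maximal_op A2 -> maximal_op A3 ->
  (forall y1 v1 y2 v2 y3 v3, A1 y1 v1 -> A2 y2 v2 -> A3 y3 v3 ->
    0 <= ip (x1 - y1) (u1 - v1) + ip (x2 - y2) (u2 - v2) + ip (x3 - y3) (u3 - v3)) ->
  [/\ A1 x1 u1, A2 x2 u2 & A3 x3 u3].
Proof.
move=> m1 m2 m3 h.
have [y1 [v1 [Ay1 le1]]] := maximal_op_le0 x1 u1 m1.
have [y2 [v2 [Ay2 le2]]] := maximal_op_le0 x2 u2 m2.
have [y3 [v3 [Ay3 le3]]] := maximal_op_le0 x3 u3 m3.
split; [apply: m1 => y v Ay|apply: m2 => y v Ay|apply: m3 => y v Ay].
- by have := h _ _ _ _ _ _ Ay Ay2 Ay3; lra.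
- by have := h _ _ _ _ _ _ Ay1 Ay Ay3; lra.
- by have := h _ _ _ _ _ _ Ay1 Ay2 Ay; lra.
Qed.

(** Products of weakly convergent sequences need not converge separately, but <x, u> + <y, v> + <y,
    q> equals <u + v + q, x> + <y - x, (u + v + q) - u>, where each product pairs a strongly null
    sequence with a bounded one. *)
Lemma demiclosed3 (T : Type) (U : set_system T) (A1 A2 A3 : V -> V -> Prop)
    (x y u v q : T -> V) (xb ub qb : V) : ProperFilter U ->
  maximally_monotone ip A1 -> maximally_monotone ip A2 ->
  maximally_monotone ip A3 ->
  (forall n, A1 (x n) (u n)) -> (forall n, A2 (y n) (v n)) ->
  (forall n, A3 (y n) (q n)) ->
  norm_bounded U x -> norm_bounded U u ->
  strong0 U (fun n => y n - x n) -> strong0 U (fun n => u n + v n + q n) ->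
  weak_lim U x xb -> weak_lim U u ub -> weak_lim U q qb ->
  [/\ A1 xb ub, A2 xb (- ub - qb) & A3 xb qb].
Proof.
move=> FU [mon1 max1] [mon2 max2] [mon3 max3] xu yv yq bx bu yx s0 xl ul ql.
have yl : weak_lim U y xb by exact: weak_lim_add_strong0 xl yx.
have vl : weak_lim U v (- ub - qb).
  have sl : weak_lim U (fun n => (-1) *: u n + (-1) *: q n) ((-1) *: ub + (-1) *: qb).
    by apply: weak_limD; exact: weak_limZ.
  rewrite !scaleN1r in sl; apply: weak_lim_add_strong0 sl _.
  rewrite (_ : (fun n => _) = (fun n => u n + v n + q n))//.
  by apply/funext => n; rewrite !scaleN1r opprD !opprK addrA [v n + _]addrC.
apply: maximal_op_sum3 => // a a' b b' c c' Aa Ab Ac.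
pose g n := ip (u n + v n + q n) (x n)
  + ip (y n - x n) ((u n + v n + q n) + (-1) *: u n)
  - ip (x n) a' - ip (u n) a + ip a a' - ip (y n) b' - ip (v n) b + ip b b'
  - ip (y n) c' - ip (q n) c + ip c c'.
have gl : g @ U --> 0 + 0 - ip xb a' - ip ub a + ip a a' - ip xb b'
    - ip (- ub - qb) b + ip b b' - ip xb c' - ip qb c + ip c c'.
  do 9 ![apply: cvgD; last by [exact: cvg_cst|apply: cvgN; auto]].
  apply: cvgD; apply: strong0_ip => //.
  by apply: norm_boundedD; [exact: strong0_bounded|exact: norm_boundedZ].
have : 0 <= 0 + 0 - ip xb a' - ip ub a + ip a a' - ip xb b'
    - ip (- ub - qb) b + ip b b' - ip xb c' - ip qb c + ip c c'.
  apply: (cvgr_to_ge gl); apply: nearW => n.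
  have := mon1 _ _ _ _ (xu n) Aa; have := mon2 _ _ _ _ (yv n) Ab.
  have := mon3 _ _ _ _ (yq n) Ac; rewrite /g !ipE.
  rewrite (ipC (v n) (x n)) (ipC (u n) (x n)) (ipC (q n) (x n)).
  rewrite (ipC (u n) a) (ipC (v n) b) (ipC (q n) c); lra.
by rewrite !ipE (ipC ub a) (ipC ub b) (ipC qb b) (ipC qb c); lra.
Qed.

(** * Opial's lemma *)

(** For two cluster points l and l' in [S], the difference of |s - l'|^2 and |s - l|^2 converges
    along [F], hence so does <s, l - l'>. Its limit equals both <l, l - l'> and <l', l - l'>, so l =
    l'. *)
Lemma opial (T : Type) (F : set_system T) (s : T -> V) (S : V -> Prop) :
  ip_complete ip -> ProperFilter F -> norm_bounded F s ->
  (forall p, S p -> exists a : R, (fun n => ip (s n - p) (s n - p)) @ F --> a) ->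
  (forall U l, UltraFilter U -> F `<=` U -> weak_lim U s l -> S l) ->
  exists2 l, S l & weak_lim F s l.
Proof.
move=> cpl FF bs Scvg Sclu.
have bU U : F `<=` U -> norm_bounded U s 
  by move=> FU; have [M sM] := bs; exists M; exact: FU.
have [U [UU FU]] := ultraFilterLemma FF.
have [l lU] := ultra_weak_lim cpl UU (bU U FU).
have Sl := Sclu U l UU FU lU.
exists l => // w; apply: cvg_ultra => U' UU' FU'.
have [l' lU'] := ultra_weak_lim cpl UU' (bU U' FU').
have Sl' := Sclu U' l' UU' FU' lU'.
suff -> : l = l' by exact: lU'.
have [a la] := Scvg l Sl; have [b lb] := Scvg l' Sl'.
pose c := 2^-1 * (b - a + ip l l - ip l' l').
have cF : (fun n => ip (s n) (l - l')) @ F --> c.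
  rewrite (_ : (fun n => _) = (fun n => 2^-1 *
     (ip (s n - l') (s n - l') - ip (s n - l) (s n - l) + ip l l - ip l' l'))).
    apply: cvgM; first exact: cvg_cst.
    apply: cvgB; last exact: cvg_cst.
    by apply: cvgD; [exact: cvgB|exact: cvg_cst].
  by apply/funext => n; rewrite !ipE (ipC l (s n)) (ipC l' (s n)); lra.
have cl : c = ip l (l - l').
  by apply: (cvg_unique _ _ (lU _)) => //; exact: cvg_trans (cvg_app _ FU) cF.
have cl' : c = ip l' (l - l').
  by apply: (cvg_unique _ _ (lU' _)) => //; exact: cvg_trans (cvg_app _ FU') cF.
apply/eqP; rewrite -subr_eq0; apply/eqP/ip_eq0.
by rewrite ipDl ipNl -cl -cl' subrr.
Qed.

(** * Inequalities for one step of the iteration *)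

(** Here [a] and [d] are increments of a resolvent J and of its argument, so [a - d] is an increment
    of J - Id. *)
Lemma firmly_nonexpansive a d : 0 <= ip a (d - a) -> ip (a - d) (a - d) <= ip d d.
Proof. by have := ip_ge0 a; rewrite !ipE (ipC d a); lra. Qed.

(** [X], [Y], [Z] are the deviations of the iterates from their fixed values and [E] that of the
    forward term. The claim is the sum of the two hypotheses, doubled and expanded. *)
Lemma douglas_rachford_step X Y Z E :
  0 <= ip X (Z - X) -> 0 <= ip Y (2 *: X - Z - Y - E) ->
  ip (Z + Y - X) (Z + Y - X) + ip (Y - X) (Y - X) <= ip Z Z - 2 * ip Y E.
Proof. by rewrite !ipE (ipC Z X) (ipC Z Y) (ipC Y X); lra. Qed.

(** Monotonicity of [B] discards <Y, bs>, while <Y, b1> and <Y - d, b0> are kept to telescope.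
    Young's inequality absorbs <d, b0> with weight [L] and <d, c> with weight 1 / (2 beta), whose
    |c|^2 term cocoercivity cancels exactly. *)
Lemma reflected_forward_bound (L beta e0 : R) Y d bs b1 b0 c :
  0 < L -> 0 < beta -> 0 <= ip Y bs -> beta * ip c c <= ip (Y - d) c ->
  ip b0 b0 <= L ^+ 2 * e0 ->
  - (2 * ip Y (bs - b1 + b0 + c)) <=
    2 * ip Y b1 - 2 * ip (Y - d) b0 + L * (ip d d + e0) + (2 * beta)^-1 * ip d d.
Proof.
move=> L0 beta0 Ybs cc b0L; have b2 : 0 < (2 * beta)^-1 by rewrite invr_gt0 mulr_gt0.
have := ip_young_norm d b0 L0; have := ip_young_norm d c b2.
have : L^-1 * ip b0 b0 <= L * e0.
  by rewrite ler_pdivrMl// mulrA -expr2.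
rewrite invrK !ler_norml; move: cc; rewrite !ipE.
by move=> cc b0e /andP[dc _] /andP[db _]; lra.
Qed.

Lemma resolvent_inj A (g : R) z x x' : 0 < g -> monotone_op ip A ->
  is_resolvent A g z x -> is_resolvent A g z x' -> x = x'.
Proof.
move=> g0 Amon [u [Axu zE]] [u' [Axu' zE']]; apply/eqP; rewrite -subr_eq0.
apply/eqP/ip_eq0; have := Amon _ _ _ _ Axu Axu'.
rewrite -(pmulr_rge0 _ g0) -ipZr.
have -> : g *: (u - u') = - (x - x').
  have gu : g *: u = z - x by rewrite zE addrAC subrr add0r.
  have gu' : g *: u' = z - x' by rewrite zE' addrAC subrr add0r.
  by rewrite scalerBr gu gu'; apply: ip_inj => w; rewrite !ipE; ring.
by rewrite ipNr => h; apply/eqP; rewrite eq_le ip_ge0 -oppr_ge0 h.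
Qed.


(** * The four-operator splitting algorithm *)

Section Splitting.
Variables (A1 A2 : V -> V -> Prop) (B C : V -> V) (L beta gamma : R).
Variables (x y z : nat -> V).
Hypothesis A1max : maximally_monotone ip A1.
Hypothesis A2max : maximally_monotone ip A2.
Hypothesis Bmon : monotone_fun ip B.
Hypothesis L_gt0 : 0 < L.
Hypothesis Blip :
  forall u v, ip (B u - B v) (B u - B v) <= L ^+ 2 * ip (u - v) (u - v).
Hypothesis beta_gt0 : 0 < beta.
Hypothesis Ccoco : cocoercive ip beta C.
Hypothesis gamma_gt0 : 0 < gamma.
(** The step-size bound with denominators cleared: it makes the descent coefficient in
    [lyapunov_descent] positive. *)
Hypothesis gamma_lt : 2 * (gamma / beta) + 8 * (gamma * L) < 1.
Hypothesis xP : forall n, A1 (x n.+1) (gamma^-1 *: (z n - x n.+1)).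
(** Indexed from [n.+2] because y_{-1} is not a term of [y]. *)
Hypothesis yP : forall n, A2 (y n.+2)
  (gamma^-1 *: (2 *: x n.+2 - z n.+1 - (2 * gamma) *: B (y n.+1)
     + gamma *: B (y n) - gamma *: C (y n.+1) - y n.+2)).
Hypothesis zP : forall n, z n.+1 = z n + y n.+1 - x n.+1.

Let gamma_neq0 : gamma != 0. Proof. by rewrite gt_eqF. Qed.

Let gammaL_ge0 : 0 <= gamma * L. Proof. by rewrite mulr_ge0// ltW. Qed.

Let gamma_beta_ge0 : 0 <= gamma / beta. Proof. by rewrite divr_ge0// ltW. Qed.

Let dz n := ip (z n.+1 - z n) (z n.+1 - z n).
Let dy n := ip (y n.+1 - y n) (y n.+1 - y n).

Lemma cocoercive_lip u v :
  ip (C u - C v) (C u - C v) <= beta^-1 ^+ 2 * ip (u - v) (u - v).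
Proof.
have bi : 0 < beta^-1 by rewrite invr_gt0.
have := ip_young (u - v) (C u - C v) bi; have := Ccoco u v.
rewrite invrK => h1 h2; rewrite expr2 -mulrA ler_pdivlMl//; lra.
Qed.

Lemma splitting_dy n : dy n.+1 <= 2 * (dz n.+1 + dz n).
Proof.
rewrite /dy.
(* By [zP], y_{n+1} = (z_{n+1} - z_n) + x_{n+1}; the terms are grouped to show an increment of J -
   Id for [A1]. *)
have -> : y n.+2 - y n.+1 = (z n.+2 - z n.+1) + ((x n.+2 - x n.+1) - (z n.+1 - z n)).
  by rewrite (zP n.+1) (zP n); apply: ip_inj => w; rewrite !ipE; ring.
apply: (le_trans (ip_sqrD _ _)); rewrite ler_pM2l// lerD2l.
apply: firmly_nonexpansive; have [mon _] := A1max.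
have := mon _ _ _ _ (xP n.+1) (xP n).
rewrite -(pmulr_rge0 _ gamma_gt0) -ipZr.
rewrite [gamma *: _](_ : _ = z n.+1 - z n - (x n.+2 - x n.+1))//.
by apply: ip_inj => w; rewrite !ipE; field.
Qed.

(** * The Lyapunov function attached to a zero *)

Section Lyapunov.
Variables (xs a1 a2 : V).
Hypothesis A1xs : A1 xs a1.
Hypothesis A2xs : A2 xs a2.
Hypothesis zero_xs : a1 + a2 + B xs + C xs = 0.
Let zs := xs + gamma *: a1.

Definition lyapunov n := ip (z n.+1 - zs) (z n.+1 - zs)
  - 2 * gamma * ip (y n.+1 - xs) (B (y n.+1) - B (y n))
  + gamma * L * dy n + (gamma / beta + 4 * (gamma * L)) * dz n.

Lemma lyapunov_descent n :
  lyapunov n.+1 + (1 - 2 * (gamma / beta) - 8 * (gamma * L)) * dz n.+1 <= lyapunov n.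
Proof.
(* This is 2 B y_{n+1} - B y_n + C y_{n+1} minus its value B xs + C xs at the zero, split to fit
   [reflected_forward_bound]. *)
pose E := B (y n.+2) - B xs - (B (y n.+2) - B (y n.+1)) + (B (y n.+1) - B (y n))
  + (C (y n.+1) - C xs).
have [mon1 _] := A1max; have [mon2 _] := A2max.
have hX : 0 <= ip (x n.+2 - xs) (z n.+1 - zs - (x n.+2 - xs)).
  have := mon1 _ _ _ _ (xP n.+1) A1xs; rewrite -(pmulr_rge0 _ gamma_gt0) -ipZr.
  rewrite [gamma *: _](_ : _ = z n.+1 - zs - (x n.+2 - xs))//.
  by apply: ip_inj => w; rewrite /zs !ipE; field.
have hY : 0 <= ip (y n.+2 - xs) (2 *: (x n.+2 - xs) - (z n.+1 - zs)
    - (y n.+2 - xs) - gamma *: E).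
  have := mon2 _ _ _ _ (yP n) A2xs; rewrite -(pmulr_rge0 _ gamma_gt0) -ipZr.
  rewrite [gamma *: (_ - a2)](_ : _ = 2 *: (x n.+2 - xs) - (z n.+1 - zs)
    - (y n.+2 - xs) - gamma *: E)//.
  have -> : a2 = - a1 - B xs - C xs.
    apply/eqP; rewrite -subr_eq0 -zero_xs; apply/eqP/ip_inj => w.
    by rewrite !ipE; ring.
  by apply: ip_inj => w; rewrite /zs /E !ipE; field.
have := douglas_rachford_step hX hY.
have -> : z n.+1 - zs + (y n.+2 - xs) - (x n.+2 - xs) = z n.+2 - zs.
  by rewrite (zP n.+1); apply: ip_inj => w; rewrite !ipE; ring.
have -> : y n.+2 - xs - (x n.+2 - xs) = z n.+2 - z n.+1.
  by rewrite (zP n.+1); apply: ip_inj => w; rewrite !ipE; ring.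
have yE : y n.+2 - xs - (y n.+2 - y n.+1) = y n.+1 - xs.
  by apply: ip_inj => w; rewrite !ipE; ring.
have := @reflected_forward_bound L beta (dy n) (y n.+2 - xs) (y n.+2 - y n.+1)
  (B (y n.+2) - B xs) (B (y n.+2) - B (y n.+1)) (B (y n.+1) - B (y n))
  (C (y n.+1) - C xs) L_gt0 beta_gt0 (Bmon _ _).
rewrite yE => /(_ (Ccoco _ _) (Blip _ _)); rewrite -(ler_pM2l gamma_gt0).
rewrite -/E -/(dy n.+1) -/(dz n.+1) ipZr /lyapunov => hE hD.
have := splitting_dy n => hdy.
(* The surplus coefficient of [dy n.+1], doubled by [splitting_dy], is exactly the weight of [dz] in
   [lyapunov]. It is paid by [dz n] in [lyapunov n] and charged twice to [dz n.+1], whence the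
   coefficient 1 - 2 gamma / beta - 8 gamma L. *)
have hk : (gamma / (2 * beta) + 2 * (gamma * L)) * dy n.+1 <=
    (gamma / (2 * beta) + 2 * (gamma * L)) * (2 * (dz n.+1 + dz n)).
  by rewrite ler_wpM2l// addr_ge0 ?mulr_ge0 ?invr_ge0 ?ltW// mulr_gt0.
have bE : gamma / (2 * beta) = 2^-1 * (gamma / beta).
  by rewrite invfM mulrCA.
have bE' : gamma * ((2 * beta)^-1 * dy n.+1) = 2^-1 * (gamma / beta) * dy n.+1.
  by rewrite mulrA bE.
rewrite bE in hk; rewrite mulrDr bE' in hE; move: hE hD hk.
by move: (gamma / beta) => k; lra.
Qed.

Lemma splitting_y_le n : ip (y n.+1 - xs) (y n.+1 - xs) <=
  8 * ip (z n.+1 - zs) (z n.+1 - zs) + 4 * dz n.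
Proof.
have [mon1 _] := A1max.
have hX : 0 <= ip (x n.+1 - xs) (z n - zs - (x n.+1 - xs)).
  have := mon1 _ _ _ _ (xP n) A1xs; rewrite -(pmulr_rge0 _ gamma_gt0) -ipZr.
  rewrite [gamma *: _](_ : _ = z n - zs - (x n.+1 - xs))//.
  by apply: ip_inj => w; rewrite /zs !ipE; field.
set Z := z n.+1 - zs; set d := z n.+1 - z n.
have -> : y n.+1 - xs = Z + ((x n.+1 - xs) - (z n - zs)).
  by rewrite /Z (zP n); apply: ip_inj => w; rewrite !ipE; ring.
apply: (le_trans (ip_sqrD _ _)).
have := firmly_nonexpansive hX.
have -> : z n - zs = Z - d.
  by rewrite /Z /d; apply: ip_inj => w; rewrite !ipE; ring.
by have := ip_sqrB Z d; have := ip_ge0 Z; rewrite -/(dz n); lra.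
Qed.

(** Young's inequality with weight [L] bounds the indefinite term by gamma L |y_{n+1} - xs|^2 +
    gamma L dy. The second part cancels in [lyapunov]; by [splitting_y_le] the first costs 4 gamma L
    dz, also present there, and 8 gamma L |z_{n+1} - zs|^2. *)
Lemma lyapunov_ge n :
  (1 - 8 * (gamma * L)) * ip (z n.+1 - zs) (z n.+1 - zs) <= lyapunov n.
Proof.
have := ip_young (y n.+1 - xs) (B (y n.+1) - B (y n)) L_gt0.
have : L^-1 * ip (B (y n.+1) - B (y n)) (B (y n.+1) - B (y n)) <= L * dy n.
  by rewrite ler_pdivrMl// mulrA -expr2; exact: Blip.
move=> hB hyoung; have {hB hyoung} :
    2 * ip (y n.+1 - xs) (B (y n.+1) - B (y n)) <=
    L * ip (y n.+1 - xs) (y n.+1 - xs) + L * dy n by lra.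
rewrite -(ler_pM2l gamma_gt0) => h.
have hY := ler_wpM2l gammaL_ge0 (splitting_y_le n).
have : 0 <= gamma / beta * dz n by rewrite mulr_ge0// ip_ge0.
by rewrite /lyapunov; move: (gamma / beta) h hY => k h hY; lra.
Qed.

Lemma lyapunov_cvg : exists a : R, lyapunov @ \oo --> a.
Proof.
have noninc : {homo lyapunov : n m / (n <= m)%N >-> m <= n}.
  apply/nonincreasing_seqP => n; apply: le_trans (lyapunov_descent n).
  rewrite lerDl mulr_ge0 ?ip_ge0//; move: gamma_lt; lra.
exists (inf (range lyapunov)); apply: nonincreasing_cvgn => //.
exists 0 => _ [n _ <-]; apply: le_trans (lyapunov_ge n).
rewrite mulr_ge0 ?ip_ge0//; move: gamma_lt gamma_beta_ge0; lra.
Qed.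

Lemma splitting_z_bounded : norm_bounded \oo (fun n => z n.+1 - zs).
Proof.
have [a la] := lyapunov_cvg; exists ((1 - 8 * (gamma * L))^-1 * (a + 1)).
move/cvgrPdist_lt/(_ 1 ltr01): la; apply: filterS => n na.
rewrite ler_pdivlMl; last by move: gamma_lt gamma_beta_ge0; lra.
apply: (le_trans (lyapunov_ge n)).
by move: na; rewrite ltr_norml => /andP[]; lra.
Qed.

Lemma splitting_dz0 : strong0 \oo (fun n => z n.+1 - z n).
Proof.
have [a la] := lyapunov_cvg.
rewrite /strong0 -/(dz _) -[X in X @ _]/dz -cvg_shiftS.
pose k := 1 - 2 * (gamma / beta) - 8 * (gamma * L).
have k0 : 0 < k by rewrite /k; move: gamma_lt; lra.
apply: (@strong0_dom _ \oo _ k^-1 (fun n => lyapunov n - lyapunov n.+1)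
  (fun n => z n.+2 - z n.+1)).
  rewrite -[X in _ --> X](subrr a); apply: cvgB => //.
  by have := la; rewrite -cvg_shiftS.
apply: nearW => n; rewrite ler_pdivlMl//.
by have := lyapunov_descent n; rewrite -/(dz n.+1) -/k; lra.
Qed.

Lemma splitting_dy0 : strong0 \oo (fun n => y n.+1 - y n).
Proof.
rewrite /strong0 -[X in X @ _]/dy -cvg_shiftS.
apply: (@strong0_dom _ \oo _ 2 (fun n => dz n.+1 + dz n)
  (fun n => y n.+2 - y n.+1)); last by apply: nearW => n; exact: splitting_dy.
rewrite -[X in _ --> X](addr0 0); apply: cvgD; last exact: splitting_dz0.
by have := splitting_dz0; rewrite /strong0 -[X in X @ _]/dz -cvg_shiftS.
Qed.

Lemma splitting_y_bounded : norm_bounded \oo (fun n => y n.+1 - xs).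
Proof.
have [M zM] := splitting_z_bounded; have [N dzN] := strong0_bounded splitting_dz0.
exists (8 * M + 4 * N); apply: filterS2 zM dzN => n zM dzN.
by apply: (le_trans (splitting_y_le n)); rewrite /dz; lra.
Qed.

(** All terms of [lyapunov] except the first tend to 0, so the first inherits its limit. *)
Lemma splitting_fejer :
  exists a : R, (fun n => ip (z n.+1 - zs) (z n.+1 - zs)) @ \oo --> a.
Proof.
have [a la] := lyapunov_cvg; exists (a + 2 * gamma * 0 - gamma * L * 0
  - (gamma / beta + 4 * (gamma * L)) * 0).
rewrite (_ : (fun n => _) = (fun n => lyapunov n
  + 2 * gamma * ip (B (y n.+1) - B (y n)) (y n.+1 - xs)
  - gamma * L * dy n - (gamma / beta + 4 * (gamma * L)) * dz n)); last first.
  by apply/funext => n; rewrite /lyapunov (ipC (B _ - _)); ring.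
apply: cvgB; last by apply: cvgM splitting_dz0; exact: cvg_cst.
apply: cvgB; last by apply: cvgM splitting_dy0; exact: cvg_cst.
apply: cvgD => //; apply: cvgM; first exact: cvg_cst.
apply: strong0_ip splitting_y_bounded; exact: strong0_lip Blip splitting_dy0.
Qed.

End Lyapunov.

(* The same [a1] must appear in the resolvent and in the zero equation. *)
Definition splitting_fixed (zb : V) : Prop := exists xb a1 a2,
  [/\ A1 xb a1, A2 xb a2, a1 + a2 + B xb + C xb = 0 & zb = xb + gamma *: a1].

(** * Cluster points and weak convergence of the iterates *)

Hypothesis fixed_ex : exists zb, splitting_fixed zb.

Lemma splitting_facts :
  [/\ strong0 \oo (fun n => z n.+1 - z n), strong0 \oo (fun n => y n.+1 - y n),
      norm_bounded \oo (fun n => z n.+1) & norm_bounded \oo (fun n => y n.+1)].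
Proof.
have [_ [xs [a1 [a2 [h1 h2 h0 _]]]]] := fixed_ex; split.
- exact: splitting_dz0 h1 h2 h0.
- exact: splitting_dy0 h1 h2 h0.
- exact: norm_bounded_translate (splitting_z_bounded h1 h2 h0).
- exact: norm_bounded_translate (splitting_y_bounded h1 h2 h0).
Qed.

(** The weak limit of x along [U] is part of the conclusion so that the limit of the whole sequence
    can be identified later. *)
Lemma cluster_fixed U zb : ip_complete ip -> UltraFilter U -> \oo `<=` U ->
  weak_lim U (fun n => z n.+1) zb ->
  exists xb a1 a2, [/\ A1 xb a1, A2 xb a2, a1 + a2 + B xb + C xb = 0,
    zb = xb + gamma *: a1 & weak_lim U (fun n => x n.+2) xb].
Proof.
move=> cpl UU ooU zl; have [dz0 dy0 zbd ybd] := splitting_facts.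
(* [B] and [C] are merged into one monotone Lipschitz map, hence a maximally monotone operator, to
   serve as the third one in [demiclosed3]. *)
pose F u := B u + C u; pose K := 2 * (L ^+ 2 + beta^-1 ^+ 2).
have K0 : 0 <= K by rewrite mulr_ge0// addr_ge0// sqr_ge0.
have Flip u v : ip (F u - F v) (F u - F v) <= K * ip (u - v) (u - v).
  rewrite [F u - F v](_ : _ = (B u - B v) + (C u - C v)); last first.
    by rewrite /F opprD addrACA.
  apply: (le_trans (ip_sqrD _ _)); rewrite /K -mulrA ler_pM2l// mulrDl.
  by rewrite lerD// ?Blip// cocoercive_lip.
have Fmax : maximally_monotone ip (fun x u => u = F x).
  split; last exact: lipschitz_maximal K0 Flip.
  move=> u v _ _ -> ->; rewrite [F u - F v](_ : _ = (B u - B v) + (C u - C v)).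
    rewrite ipDr addr_ge0//; apply: le_trans (Ccoco u v).
    by rewrite mulr_ge0 ?ip_ge0// ltW.
  by rewrite /F opprD addrACA.
have dz1 : strong0 \oo (fun n => z n.+2 - z n.+1) by apply: strong0_shift dz0.
have dy1 : strong0 \oo (fun n => y n.+2 - y n.+1) by apply: strong0_shift dy0.
have ybd2 : norm_bounded U (fun n => y n.+2).
  apply: norm_bounded_sub ooU _.
  have : norm_bounded \oo (fun n => y n.+1 + (y n.+2 - y n.+1)).
    by apply: norm_boundedD => //; exact: strong0_bounded.
  by under eq_fun do rewrite addrC subrK.
have yx0 : strong0 U (fun n => y n.+2 - x n.+2).
  apply: strong0_sub ooU _.
  rewrite (_ : (fun n => _) = (fun n => z n.+2 - z n.+1))//.
  by apply/funext => n; rewrite (zP n.+1); apply: ip_inj => w; rewrite !ipE; ring.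
have xbd2 : norm_bounded U (fun n => x n.+2).
  have : norm_bounded U (fun n => y n.+2 - (y n.+2 - x n.+2)).
    by apply: norm_boundedB => //; exact: strong0_bounded.
  by under eq_fun do rewrite opprB addrC subrK.
have [xb xl] := ultra_weak_lim cpl UU xbd2.
have [qb ql] := ultra_weak_lim cpl UU (norm_bounded_lip K0 Flip ybd2).
have ul : weak_lim U (fun n => gamma^-1 *: (z n.+1 - x n.+2)) (gamma^-1 *: (zb - xb)).
  by apply: weak_limZ; exact: weak_limB.
have ubd : norm_bounded U (fun n => gamma^-1 *: (z n.+1 - x n.+2)).
  by apply: norm_boundedZ; apply: norm_boundedB xbd2; exact: norm_bounded_sub ooU zbd.
have [|A1b A2b qE] := demiclosed3 _ A1max A2max Fmax (fun n => xP n.+1) yP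
  (fun n => erefl (F (y n.+2))) xbd2 ubd yx0 _ xl ul ql.
(* The residual reduces to y - x and increments of [B] and [C] along y, all strongly null. *)
- rewrite (_ : (fun n => _) = (fun n => (-1) *: (gamma^-1 *: (y n.+2 - x n.+2))
      + (B (y n.+2) - B (y n.+1)) + (-1) *: (B (y n.+1) - B (y n))
      + (C (y n.+2) - C (y n.+1)))); last first.
    by apply/funext => n; apply: ip_inj => w; rewrite /F !ipE; field.
  apply: strong0D; last first.
    by apply: strong0_lip cocoercive_lip _; apply: strong0_sub ooU _.
  apply: strong0D; last first.
    by apply: strong0Z; apply: strong0_lip Blip _; apply: strong0_sub ooU _.
  apply: strong0D; last by apply: strong0_lip Blip _; apply: strong0_sub ooU _.
  by do 2!apply: strong0Z.
exists xb, (gamma^-1 *: (zb - xb)), (- (gamma^-1 *: (zb - xb)) - qb).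
split => //.
- by rewrite qE /F; apply: ip_inj => w; rewrite ip0l !ipE; ring.
- by rewrite scalerA mulfV// scale1r addrC subrK.
Qed.

Lemma splitting_weak_cvg : ip_complete ip -> exists zb xb a1 a2,
  [/\ A1 xb a1, A2 xb a2, a1 + a2 + B xb + C xb = 0 & zb = xb + gamma *: a1] /\
  [/\ weak_cvg ip z zb, weak_cvg ip x xb & weak_cvg ip y xb].
Proof.
move=> cpl; have [dz0 dy0 zbd ybd] := splitting_facts.
have [||zb [xb [a1 [a2 [h1 h2 h0 zbE]]]] zl] :=
  @opial _ \oo (fun n => z n.+1) splitting_fixed cpl _ zbd.
- by move=> _ [xs [a1 [a2 [h1 h2 h0 ->]]]]; exact: splitting_fejer h1 h2 h0.
- move=> U l UU ooU lU.
  by have [xb [a1 [a2 [h1 h2 h0 lE _]]]] := cluster_fixed cpl UU ooU lU; exists xb, a1, a2.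
(* Resolvents need not be weakly continuous. Instead, along each ultrafilter x has a weak limit that
   is the resolvent of [zb], and [resolvent_inj] makes these limits agree. *)
have xl : weak_lim \oo (fun n => x n.+2) xb.
  move=> w; apply: cvg_ultra => U UU ooU.
  have zU : weak_lim U (fun n => z n.+1) zb.
    by move=> v; exact: cvg_trans (cvg_app _ ooU) (zl v).
  have [xb' [b1 [b2 [k1 _ _ zbE' xl]]]] := cluster_fixed cpl UU ooU zU.
  suff -> : xb = xb' by exact: xl.
  have [mon _] := A1max.
  by apply: (@resolvent_inj A1 gamma zb) => //; [exists a1|exists b1].
have yl : weak_lim \oo (fun n => y n.+2) xb.
  apply: weak_lim_add_strong0 xl _.
  rewrite (_ : (fun n => _) = (fun n => z n.+2 - z n.+1)).
    exact: strong0_shift dz0.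
  by apply/funext => n; rewrite (zP n.+1); apply: ip_inj => w; rewrite !ipE; ring.
exists zb, xb, a1, a2; split => //; split => w.
- by rewrite -cvg_shiftS; exact: zl.
- by rewrite -cvg_shiftS -(cvg_shiftS (fun n => ip (x n.+1) w)); exact: xl.
- by rewrite -cvg_shiftS -(cvg_shiftS (fun n => ip (y n.+1) w)); exact: yl.
Qed.

End Splitting.
End InnerProduct.

(* y : nat -> V is y_0, y_1, ...; ym1 is y_{-1}.  x 0 is unused (x starts at x_1). *)
Theorem theorem3p1 (R : realType) (V : lmodType R) (ip : V -> V -> R)
  (A1 A2 : V -> V -> Prop) (B C : V -> V) (L beta gamma : R)
  (x y z : nat -> V) (ym1 : V) :
  is_hilbert ip ->
  maximally_monotone ip A1 -> maximally_monotone ip A2 ->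
  monotone_fun ip B -> 0 < L -> lipschitz_fun ip L B ->
  0 < beta -> cocoercive ip beta C ->
  (exists x0, in_zer4 A1 A2 B C x0) ->
  0 < gamma -> gamma < beta / (2 * (1 + 4 * beta * L)) ->
  (forall n : nat,
     let yprev := if n is k.+1 then y k else ym1 in
     is_resolvent A1 gamma (z n) (x n.+1) /\
     is_resolvent A2 gamma
       (2 *: x n.+1 - z n - (2 * gamma) *: B (y n) + gamma *: B yprev
          - gamma *: C (y n)) (y n.+1) /\
     z n.+1 = z n + y n.+1 - x n.+1) ->
  exists zbar xbar : V,
    weak_cvg ip z zbar /\
    weak_cvg ip x xbar /\ weak_cvg ip y xbar /\
    is_resolvent A1 gamma zbar xbar /\ in_zer4 A1 A2 B C xbar.
Proof.
move=> [ipP cpl] A1max A2max Bmon L0 Blip b0 Ccoco [xs [a1 [a2 [h1 [h2 h0]]]]] g0 glt H.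
have Blip2 u v : ip (B u - B v) (B u - B v) <= L ^+ 2 * ip (u - v) (u - v).
  have LB0 : 0 <= L * hnorm ip (u - v) by rewrite mulr_ge0 ?sqrtr_ge0 ?ltW.
  have := lerXn2r 2 (sqrtr_ge0 _ : _ \in Num.nneg) (LB0 : _ \in Num.nneg) (Blip u v).
  by rewrite exprMn !sqr_sqrtr ?(ip_ge0 ipP).
(* Multiplying by [beta] turns this into 2 gamma + 8 gamma beta L < beta, the assumed bound. *)
have gbL : 2 * (gamma / beta) + 8 * (gamma * L) < 1.
  rewrite -(ltr_pM2r b0) mulrDl mul1r mulrA divfK ?gt_eqF//.
  by move: glt; rewrite ltr_pdivlMr; [lra|rewrite mulr_gt0// addr_gt0// !mulr_gt0].
have g_neq0 : gamma != 0 by rewrite gt_eqF.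
have res A a b : is_resolvent A gamma a b -> A b (gamma^-1 *: (a - b)).
  move=> [u [Abu ->]]; rewrite (_ : b + gamma *: u - b = gamma *: u).
    by rewrite scalerA mulVf// scale1r.
  by rewrite addrAC subrr add0r.
have [|||||zb [xb [c1 [c2 [[k1 k2 k0 zbE] [zl xl yl]]]]]] :=
  @splitting_weak_cvg R V ip ipP A1 A2 B C L beta gamma x y z A1max A2max Bmon L0
    Blip2 b0 Ccoco g0 gbL.
- by move=> n; apply: res; case: (H n).
(* At index [n.+1] the term [yprev] reduces to [y n]. *)
- by move=> n; apply: res; case: (H n.+1) => _ [].
- by move=> n; case: (H n) => _ [].
- by exists (xs + gamma *: a1), xs, a1, a2.
- by [].
exists zb, xb; split=> //; split=> //; split=> //; split; first by exists c1.
by exists c1, c2.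
Qed.
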